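(* Let $n\ge 1$, $c\in\mathbb{R}^n$, and let $a_0,a_1,\dots,a_n:[0,2\pi]\to\mathbb{R}$. Let $(P)$ be the linear semi-infinite program $$(P)\quad \min\ c^{\top}x\quad\text{s.t.}\quad \sum_{j=1}^n a_j(t)x_j\le a_0(t)\ \ \forall t\in[0,2\pi],\qquad x\in\mathbb{R}^n .$$ Suppose the following conditions hold: (a) $a_j$, $j=0,\dots,n$, are Lipschitz continuous on $[0,2\pi]$; (b) $a_j(0)=a_j(2\pi)$, $j=0,\dots,n$; (c) (Slater condition for $(P)$) there exists $\hat x\in\mathbb{R}^n$ with $\sum_{j=1}^n a_j(t)\hat x_j<a_0(t)$ for all $t\in[0,2\pi]$; (d) there exist $\tilde x\in\mathbb{R}^n$ and $Q<0$ such that $\sum_{j=1}^n a_j(t)\tilde x_j\le Q$ for all $t\in[0,2\pi]$; (e) $c\neq 0$, $S(P)\neq\emptyset$, and $R$ is a real number with $\|x\|\le R$ for all $x\in S(P)$. Let $A>0$ be a constant such that $|a_j(t)-\hat a_j^K(t)|\le A\frac{\ln K}{K}$ for all $t\in[0,2\pi]$, all $j=0,\dots,n$ and all integers $K\ge 2$. Let the programs $(FP_K)$, $(AFP_K)$ (which uses $A$ and $R$) and $(TFP_K)$ be as defined in the context. Then: (a) for all sufficiently large $K$, the Slater condition holds for $(FP_K)$, i.e. there exists $x\in\mathbb{R}^n$ with $\sum_{j=1}^n\hat a_j^K(t)x_j<\hat a_0^K(t)$ for all $t\in[0,2\pi]$; (b) for all sufficiently large $K$, if $\tilde x^K\in S(AFP_K)$,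 then $\tilde x^K$ is a $\frac{\ln K}{K}$-optimal solution of $(P)$; (c) for all sufficiently large $K$, if $(\tilde x^* )^K\in S(FP_K)$, then $(\tilde x^* )^K$ is a $\frac{\ln K}{K}$-optimal solution of $(P)$; (d) for all sufficiently large $K$, if $((x^* )^K,(Y^* )^K)\in S(TFP_K)$ for some $(Y^* )^K\succeq 0$, then $(x^* )^K$ is a $\frac{\ln K}{K}$-optimal solution of $(P)$. Here, in (b), (c), (d), the constant $L$ in the definition of $\varepsilon$-optimal solution can be chosen independently of $K$ (and of the chosen solutions).
   Context: Notation. For a program $(X)$, $F(X)$, $S(X)$, $v(X)$ denote its feasible set, set of optimal solutions, and optimal value. $\|\cdot\|$ is the Euclidean norm and $d(x,\Omega)=\min\{\|x-y\|:y\in\Omega\}$. $i$ is the imaginary unit. $A\succeq 0$ means $A$ is (symmetric) positive semidefinite. $\varepsilon$-optimal solution. A point $x^*\in\mathbb{R}^n$ is an $\varepsilon$-optimal solution of $(P)$ if there is a constant $L>0$ such that $|c^{\top}x^*-v(P)|\le L\varepsilon$ and $d(x^*,F(P))\le L\varepsilon$. For a family of points indexed by $K$ with $\varepsilon=\varepsilon(K)$, the constant $L$ is the same for all (sufficiently large) $K$. Fourier data. For $j=0,\dots,n$ and $k\in\mathbb{Z}$ put $a_{j,k}=\frac{1}{2\pi}\int_0^{2\pi}a_j(t)e^{ikt}\,dt=r_{j,k}+i\,s_{j,k}$ with $r_{j,k},s_{j,k}\in\mathbb{R}$, and for a positive integer $K$ (the truncation factor) let $\hat a_j^K(t)=\sum_{k=-K}^{K}a_{j,k}e^{-ikt}$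 (a real-valued function). Program $(FP_K)$: $\min\ c^{\top}x$ over $x\in\mathbb{R}^n$ s.t. $\sum_{j=1}^n\hat a_j^K(t)x_j\le \hat a_0^K(t)$ for all $t\in[0,2\pi]$. Program $(AFP_K)$: $\min\ c^{\top}x$ over $x\in\mathbb{R}^n$ s.t. $\sum_{j=1}^n\hat a_j^K(t)x_j\le \hat a_0^K(t)+2(nR+1)A\frac{\ln K}{K}$ for all $t\in[0,2\pi]$. Program $(TFP_K)$ (a linear semidefinite program in $x\in\mathbb{R}^n$ and a real symmetric matrix $Y\in\mathbb{R}^{2(K+1)\times 2(K+1)}$): $$\min\ c^{\top}x\quad\text{s.t.}\quad \bar{\mathcal C}_1^K Y+(E^K)^{\top}x-p^K=0,\quad \bar{\mathcal C}_2^K Y-(F^K)^{\top}x+q^K=0,\quad Y\succeq 0,$$ where: for a finite family of matrices $\mathcal C=\{\mathcal C_j\}$, $\mathcal CY$ is the vector with entries $(\mathcal CY)_j=\mathrm{Tr}(\mathcal C_jY)$; $\bar{\mathcal C}_1^K=\{\bar{\mathcal C}_{1,j}^K\}_{j=0}^K$ with $\bar{\mathcal C}_{1,j}^K=\begin{pmatrix}\mathcal C_{1,j}^K&0\\0&\mathcal C_{1,j}^K\end{pmatrix}$, where $\mathcal C_{1,j}^K\in\mathbb{R}^{(K+1)\times(K+1)}$ has $(k,l)$ entry $1$ if $|k-l|=j$ and $0$ otherwise; $\bar{\mathcal C}_2^K=\{\bar{\mathcal C}_{2,j}^K\}_{j=1}^K$ with $\bar{\mathcal C}_{2,j}^K=\begin{pmatrix}0&-\mathcal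 C_{2,j}^K\\ \mathcal C_{2,j}^K&0\end{pmatrix}$, where $\mathcal C_{2,j}^K\in\mathbb{R}^{(K+1)\times(K+1)}$ has $(k,l)$ entry $1$ if $l-k=j$, $-1$ if $k-l=j$, and $0$ otherwise; $p^K\in\mathbb{R}^{K+1}$ has entries $p^K_0=r_{0,0}$ and $p^K_k=r_{0,k}+r_{0,-k}$ for $k=1,\dots,K$; $q^K\in\mathbb{R}^K$ has entries $q^K_k=s_{0,k}-s_{0,-k}$ for $k=1,\dots,K$; $E^K\in\mathbb{R}^{n\times(K+1)}$ has entries $E^K_{j,0}=r_{j,0}$ and $E^K_{j,k}=r_{j,k}+r_{j,-k}$ for $j=1,\dots,n$, $k=1,\dots,K$; $F^K\in\mathbb{R}^{n\times K}$ has entries $F^K_{j,k}=s_{j,k}-s_{j,-k}$ for $j=1,\dots,n$, $k=1,\dots,K$. *)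

(* Defs.v *)
From HB Require Import structures.
From mathcomp Require Import all_boot all_order all_algebra.
From mathcomp Require Import all_classical all_reals all_analysis.
From mathcomp Require Import complex.

Set Implicit Arguments.
Unset Strict Implicit.
Unset Printing Implicit Defensive.

Import Order.TTheory GRing.Theory Num.Theory.
Import numFieldNormedType.Exports.

Local Open Scope classical_set_scope.
Local Open Scope ring_scope.

Record program (R : realType) (V : Type) :=
  Program { feasible : set V ; objective : V -> R }.

Definition optimal (R : realType) (V : Type) (P : program R V) : set V :=
  [set x | feasible P x /\
           forall y, feasible P y -> objective P x <= objective P y].

Definition optimal_value (R : realType) (V : Type) (P : program R V) : \bar R :=
  ereal_inf [set (objective P x)%:E | x in feasible P].

Definition dot (R : realType) (n : nat) (u v : 'cV[R]_n) : R :=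
  (u^T *m v) 0 0.

(* The library norm on matrices is the maximum norm, hence a separate
   definition of the Euclidean norm. *)
Definition enorm (R : realType) (n : nat) (x : 'cV[R]_n) : R :=
  Num.sqrt (\sum_(i < n) x i 0 ^+ 2).

(* The infimum is a minimum when S is closed and nonempty; [inf] of the empty
   set is 0. *)
Definition edist (R : realType) (n : nat) (x : 'cV[R]_n) (S : set 'cV[R]_n) : R :=
  inf [set enorm (x - y) | y in S].

(* The constant L is a parameter, so that its uniformity over a family of
   points is expressed by the place of its quantifier. The first inequality is
   between extended reals; it fails when the optimal value is infinite. *)
Definition eps_optimal (R : realType) (n : nat) (P : program R 'cV[R]_n)
    (L eps : R) (x : 'cV[R]_n) : Prop :=
  (`|(objective P x)%:E - optimal_value P| <= (L * eps)%:E)%E /\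
  edist x (feasible P) <= L * eps.

(* Linear semi-infinite programs over [0, 2 pi]. A family b : 'I_n.+1 -> R -> R
   holds the right-hand side b_0 at index ord0 and the coefficient of the j-th
   variable at index lift ord0 j; only the values on [0, 2 pi] are used. *)
Definition lhs (R : realType) (n : nat) (b : 'I_n.+1 -> R -> R)
    (x : 'cV[R]_n) (t : R) : R :=
  \sum_(j < n) b (lift ord0 j) t * x j 0.

(* The right-hand side is relaxed by the constant delta. *)
Definition relaxed_lsip (R : realType) (n : nat) (c : 'cV[R]_n)
    (b : 'I_n.+1 -> R -> R) (delta : R) : program R 'cV[R]_n :=
  Program
    [set x | forall t, t \in `[0, 2 * pi] -> lhs b x t <= b ord0 t + delta]
    (dot c).

Definition lsip (R : realType) (n : nat) (c : 'cV[R]_n)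
    (b : 'I_n.+1 -> R -> R) : program R 'cV[R]_n :=
  Program
    [set x | forall t, t \in `[0, 2 * pi] -> lhs b x t <= b ord0 t]
    (dot c).

Definition slater (R : realType) (n : nat) (b : 'I_n.+1 -> R -> R) : Prop :=
  exists x : 'cV[R]_n,
    forall t, t \in `[0, 2 * pi] -> lhs b x t < b ord0 t.

Definition expi (R : realType) (t : R) : R[i] := Complex (cos t) (sin t).

Definition cintegral (R : realType) (f : R -> R[i]) : R[i] :=
  Complex (\int[lebesgue_measure]_(t in `[0, 2 * pi]) complex.Re (f t))
          (\int[lebesgue_measure]_(t in `[0, 2 * pi]) complex.Im (f t)).

Definition fourier_coef (R : realType) (f : R -> R) (k : int) : R[i] :=
  ((2 * pi)^-1)%:C%C * cintegral (fun t => (f t)%:C%C * expi (k%:~R * t)).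

(* The sum over the integers k = -K, ..., K, reindexed by m = k + K. *)
Definition cfourier_sum (R : realType) (f : R -> R) (K : nat) (t : R) : R[i] :=
  \sum_(m < (2 * K).+1)
     let k := m%:Z - K%:Z in fourier_coef f k * expi (- (k%:~R * t)).

(* No information is lost here: for continuous f the sum is real, see
   [cfourier_sum_real]. *)
Definition fourier_sum (R : realType) (f : R -> R) (K : nat) (t : R) : R :=
  complex.Re (cfourier_sum f K t).

Definition re_coef (R : realType) (f : R -> R) (k : int) : R :=
  complex.Re (fourier_coef f k).
Definition im_coef (R : realType) (f : R -> R) (k : int) : R :=
  complex.Im (fourier_coef f k).

Definition rate (R : realType) (K : nat) : R := ln K%:R / K%:R.

Definition fourier_family (R : realType) (n : nat) (a : 'I_n.+1 -> R -> R)
    (K : nat) : 'I_n.+1 -> R -> R := fun j => fourier_sum (a j) K.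

Definition FP (R : realType) (n : nat) (c : 'cV[R]_n) (a : 'I_n.+1 -> R -> R)
    (K : nat) : program R 'cV[R]_n :=
  lsip c (fourier_family a K).

Definition AFP (R : realType) (n : nat) (c : 'cV[R]_n) (a : 'I_n.+1 -> R -> R)
    (A rad : R) (K : nat) : program R 'cV[R]_n :=
  relaxed_lsip c (fourier_family a K) (2 * (n%:R * rad + 1) * A * rate R K).

Definition psd (R : realType) (m : nat) (Y : 'M[R]_m) : Prop :=
  Y^T = Y /\ forall v : 'cV[R]_m, 0 <= dot v (Y *m v).

Definition trace_map (R : realType) (m p : nat) (C : 'I_p -> 'M[R]_m)
    (Y : 'M[R]_m) : 'cV[R]_p :=
  \col_j \tr (C j *m Y).

Definition C1 (R : realType) (K j : nat) : 'M[R]_K.+1 :=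
  \matrix_(k, l) (`|k%:Z - l%:Z| == j%:Z)%:R.

Definition C2 (R : realType) (K j : nat) : 'M[R]_K.+1 :=
  \matrix_(k, l) (if l%:Z - k%:Z == j%:Z then 1
                  else if k%:Z - l%:Z == j%:Z then -1 else 0).

Definition C1bar (R : realType) (K : nat) (j : 'I_K.+1) : 'M[R]_(K.+1 + K.+1) :=
  block_mx (C1 R K j) 0 0 (C1 R K j).

(* The index ranges over 1, ..., K, written j.+1 for j : 'I_K; likewise in qvec
   and Fmx. *)
Definition C2bar (R : realType) (K : nat) (j : 'I_K) : 'M[R]_(K.+1 + K.+1) :=
  block_mx 0 (- C2 R K j.+1) (C2 R K j.+1) 0.

Definition re_entry (R : realType) (f : R -> R) (k : nat) : R :=
  if k == 0%N then re_coef f 0 else re_coef f k%:Z + re_coef f (- k%:Z).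

Definition im_entry (R : realType) (f : R -> R) (k : nat) : R :=
  im_coef f k%:Z - im_coef f (- k%:Z).

Definition pvec (R : realType) (n : nat) (a : 'I_n.+1 -> R -> R) (K : nat) :
    'cV[R]_K.+1 := \col_k re_entry (a ord0) k.

Definition qvec (R : realType) (n : nat) (a : 'I_n.+1 -> R -> R) (K : nat) :
    'cV[R]_K := \col_k im_entry (a ord0) k.+1.

Definition Emx (R : realType) (n : nat) (a : 'I_n.+1 -> R -> R) (K : nat) :
    'M[R]_(n, K.+1) := \matrix_(j, k) re_entry (a (lift ord0 j)) k.

Definition Fmx (R : realType) (n : nat) (a : 'I_n.+1 -> R -> R) (K : nat) :
    'M[R]_(n, K) := \matrix_(j, k) im_entry (a (lift ord0 j)) k.+1.

Definition TFP (R : realType) (n : nat) (c : 'cV[R]_n) (a : 'I_n.+1 -> R -> R)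
    (K : nat) : program R ('cV[R]_n * 'M[R]_(K.+1 + K.+1)) :=
  Program
    [set xY | [/\ trace_map (@C1bar R K) xY.2 + (Emx a K)^T *m xY.1 - pvec a K = 0,
                  trace_map (@C2bar R K) xY.2 - (Fmx a K)^T *m xY.1 + qvec a K = 0
                & psd xY.2]]
    (fun xY => dot c xY.1).

Lemma fourier_coefE (R : realType) (f : R -> R) (k : int) :
  fourier_coef f k =
  Complex
    ((2 * pi)^-1 *
       \int[lebesgue_measure]_(t in `[0, 2 * pi]) (f t * cos (k%:~R * t)))
    ((2 * pi)^-1 *
       \int[lebesgue_measure]_(t in `[0, 2 * pi]) (f t * sin (k%:~R * t))).
Proof.
rewrite /fourier_coef /cintegral; apply/eqP; rewrite eq_complex /=.
rewrite !mul0r subr0 addr0; apply/andP; split; apply/eqP; congr (_ * _);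
  apply: eq_Rintegral => t _ /=; by rewrite mul0r ?subr0 ?addr0.
Qed.

Lemma cfourier_sum_real (R : realType) (f : R -> R) (K : nat) (t : R) :
  {within `[0, 2 * pi], continuous f} ->
  cfourier_sum f K t = (fourier_sum f K t)%:C%C.
Proof.
move=> fc.
have coefN k : fourier_coef f (- k) = conjc (fourier_coef f k).
  rewrite !fourier_coefE /=; apply/eqP; rewrite eq_complex /=.
  apply/andP; split; apply/eqP.
    congr (_ * _); apply: eq_Rintegral => s _.
    by rewrite mulrNz mulNr cosN.
  rewrite -mulrN; congr (_ * _).
  rewrite -mulN1r -RintegralZl//.
    by apply: eq_Rintegral => s _; rewrite mulrNz mulNr sinN mulrN mulN1r.
  apply: continuous_compact_integrable; first exact: segment_compact.
  move=> s; apply: cvgM; first exact: fc.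
  apply: (@continuous_subspaceT _ _ `[0, 2 * pi] (fun u : R => sin (k%:~R * u))).
  move=> u; apply: continuous_comp; last exact: continuous_sin.
  by apply: cvgM; [exact: cvg_cst|exact: cvg_id].
have expiN u : expi (- u) = conjc (expi u) :> R[i].
  by rewrite /expi cosN sinN.
have conjM (u v : R[i]) : conjc (u * v) = conjc u * conjc v.
  exact: rmorphM.
have sum_conj : conjc (cfourier_sum f K t) = cfourier_sum f K t.
  rewrite /cfourier_sum (rmorph_sum (@conjc R)) [RHS](reindex_inj rev_ord_inj).
  apply: eq_bigr => m _; apply: etrans (conjM _ _) _.
  rewrite -coefN -expiN.
  suff -> : (rev_ord m)%:Z - K%:Z = - (m%:Z - K%:Z) by rewrite mulrNz mulNr.
  rewrite /= subSS -subzn; last by rewrite -ltnS.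
  have -> : (2 * K)%:Z = K%:Z + K%:Z by rewrite mul2n -addnn PoszD.
  by rewrite opprB addrAC addrK.
rewrite /fourier_sum; case: (cfourier_sum f K t) sum_conj => x y [] /eqP.
by rewrite -subr_eq0 -opprD oppr_eq0 -mulr2n mulrn_eq0 /= => /eqP ->.
Qed.

(* Main.v *)
Require Import Defs.
From HB Require Import structures.
From mathcomp Require Import all_boot all_order all_algebra.
From mathcomp Require Import all_classical all_reals all_analysis.
From mathcomp Require Import complex.
From mathcomp Require Import ring lra zify.

(* Perturbing the data of a linear program by [eps] moves the feasible points
   of (P) by [O(eps)] along the direction [xt] of condition (d), as long as the
   points considered stay bounded.  Boundedness is uniform in [K]: since the
   solution set of (P) is bounded, (P) has no recession direction along which
   the objective does not increase, so by compactness of the unit sphere some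
   constraint function or the objective grows linearly in every direction.
   With [xs] optimal for (P), the point [xs + C * eps *: xt] is strictly
   feasible for the truncated program and bounds its value from above.

   For the semidefinite program, a feasible matrix writes the slack
   [a_0(t) - sum_j a_j(t) x_j] of the truncated constraint as a sum of two
   quadratic forms, hence it is nonnegative; conversely, a positive slack is the
   squared modulus of a polynomial on the unit circle (Fejer-Riesz), which gives
   a feasible matrix of rank one. *)

Set Implicit Arguments.
Unset Strict Implicit.
Unset Printing Implicit Defensive.

Import Order.TTheory GRing.Theory Num.Theory.
Import numFieldNormedType.Exports.

Local Open Scope classical_set_scope.
Local Open Scope ring_scope.

(** * The Fejer-Riesz theorem *)

(** The Cayley transform maps the naturals injectively into the circle, so a nonzero [p - q] would
    have more roots than its size allows. *)
Lemma eq_poly_circle (C : numClosedFieldType) (p q : {poly C}) :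
  (forall z, `|z| = 1 -> p.[z] = q.[z]) -> p = q.
Proof.
move=> pq; apply/eqP; rewrite -subr_eq0; apply/negPn/negP => d0.
have nz (u : nat) : 1 - 'i * u%:R != 0 :> C.
  rewrite subr_eq0; apply/negP => /eqP /(congr1 (fun x => x ^+ 2)).
  rewrite exprMn sqrCi expr1n mulN1r => e.
  have : 0 < 1 + (u%:R : C) ^+ 2 by rewrite -natrX nat1r ltr0n.
  by rewrite [X in X + _]e addNr ltxx.
pose f (u : nat) : C := (1 + 'i * u%:R) / (1 - 'i * u%:R).
have f_inj : injective f.
  move=> u v /eqP; rewrite eqr_div // => /eqP e.
  have : 2 * 'i * (u%:R - v%:R) = 0 :> C.
    apply/eqP; rewrite -(subrr ((1 + 'i * u%:R) * (1 - 'i * v%:R))).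
    by rewrite {2}e; apply/eqP; ring.
  move/eqP; rewrite mulf_eq0 mulf_eq0 pnatr_eq0 /= (negPf (neq0Ci _)) /=.
  by rewrite subr_eq0 eqr_nat => /eqP.
have f1 u : `|f u| = 1.
  rewrite normrM normfV -(norm_conjC (1 + _)) rmorphD rmorphM /= conjCi.
  by rewrite conjC1 conjC_nat mulNr divff // normr_eq0.
have := @max_poly_roots _ (p - q) [seq f u | u <- iota 0 (size (p - q))] d0.
rewrite size_map size_iota ltnn map_inj_uniq // iota_uniq => h.
suff : false by []. apply: h => //.
apply/allP => _ /mapP[u _ ->].
by rewrite rootE hornerD hornerN pq ?subrr.
Qed.

(** The conjugate reciprocal polynomial for a nominal degree [N]. *)
Definition conj_rev (C : numClosedFieldType) (N : nat) (p : {poly C}) :=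
  \poly_(i < N.+1) (p`_(N - i))^*.

Lemma horner_conj_rev (C : numClosedFieldType) N (p : {poly C}) (z : C) :
  (size p <= N.+1)%N -> z != 0 ->
  (conj_rev N p).[z] = z ^+ N * (p.[(z^*)^-1])^*.
Proof.
move=> sp z0; rewrite horner_poly (horner_coef_wide _ sp).
rewrite rmorph_sum mulr_sumr [RHS](reindex_inj rev_ord_inj) /=.
apply: eq_bigr => i _; rewrite subSS rmorphM rmorphXn /= fmorphV /= conjCK.
have le : (i <= N)%N by rewrite -ltnS.
rewrite mulrCA; congr (_ * _); rewrite -{2}(subnK le) exprD exprVn.
by rewrite mulrAC divff ?mul1r // expf_neq0.
Qed.

Lemma conj_rev_id (C : numClosedFieldType) K (p : {poly C}) :
  (size p <= K.*2.+1)%N ->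
  (forall z, `|z| = 1 -> p.[z] / z ^+ K \is Num.real) -> conj_rev K.*2 p = p.
Proof.
move=> sp pr; apply: eq_poly_circle => z z1.
have z0 : z != 0 by rewrite -normr_eq0 z1 oner_eq0.
have zz : z * z^* = 1 by rewrite -normCK z1 expr1n.
have zV : (z^*)^-1 = z.
  rewrite -[RHS]mulr1 -(divff (_ : z^* != 0)) ?conjC_eq0 //.
  by rewrite mulrA zz mul1r.
rewrite horner_conj_rev // zV.
have /CrealP := pr z z1; rewrite rmorphM fmorphV /= rmorphXn /=.
have -> : z^* = z^-1 by rewrite -{2}zV invrK.
rewrite exprVn invrK => e.
rewrite -addnn exprD -mulrA [z ^+ K * _^*]mulrC e.
by rewrite mulrC divfK // expf_neq0.
Qed.

(* Roots off the circle come in pairs [alpha], [1 / alpha^*], and the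
   corresponding factor of [p] is [- z * `|z - alpha| ^+ 2 / alpha^*] on the
   circle. *)
Lemma fejer_riesz (C : numClosedFieldType) K (p : {poly C}) :
  (size p <= K.*2.+1)%N -> (forall z, `|z| = 1 -> 0 < p.[z] / z ^+ K) ->
  exists2 h : {poly C}, (size h <= K.+1)%N &
    forall z, `|z| = 1 -> p.[z] / z ^+ K = `|h.[z]| ^+ 2.
Proof.
elim: K p => [|K IH] p sp p_gt0.
  have [c pE] : exists c, p = c%:P by exists p`_0; apply: size1_polyC.
  rewrite {p sp}pE in p_gt0 *.
  have c0 : 0 < c by have := p_gt0 1 (normr1 _); rewrite hornerC expr0 divr1.
  exists (sqrtC c)%:P; first exact: size_polyC_leq1.
  move=> z _; rewrite !hornerC expr0 divr1 ger0_norm ?sqrtCK //.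
  by rewrite sqrtC_ge0 ltW.
have circ_neq0 z : `|z| = 1 -> z != 0 :> C.
  by move=> z1; rewrite -normr_eq0 z1 oner_eq0.
have p_sym : conj_rev K.+1.*2 p = p.
  by apply: conj_rev_id => // z z1; apply/gtr0_real/p_gt0.
have p_coef i : (i <= K.+1.*2)%N -> p`_i = (p`_(K.+1.*2 - i))^*.
  by move=> le; rewrite -{1}p_sym coef_poly ltnS le.
(* By symmetry the top coefficient vanishes too; dividing by ['X] then lowers [K] by one. *)
have [p00|p00] := eqVneq p`_0 0.
  have /factor_theorem[q qE] : root p 0 by rewrite rootE horner_coef0 p00.
  rewrite subr0 in qE.
  have q_div z : `|z| = 1 -> p.[z] / z ^+ K.+1 = q.[z] / z ^+ K.
    move=> /circ_neq0 z0; rewrite qE hornerMX exprSr.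
    by rewrite -mulf_div divff ?mulr1.
  have sq : (size q <= K.*2.+1)%N.
    have sp' : (size p <= K.+1.*2)%N.
      apply/leq_sizeP => j; rewrite leq_eqVlt => /predU1P[<-|].
        by rewrite p_coef // subnn p00 conjC0.
      by move=> lt; apply: nth_default; apply: leq_trans sp _.
    have [->|q0] := eqVneq q 0; first by rewrite size_poly0.
    by move: sp'; rewrite qE size_mulX // doubleS.
  have [z z1|h sh hE] := IH q sq; first by rewrite -q_div // p_gt0.
  by exists h => [|z z1]; [exact: leq_trans sh _|rewrite q_div // hE].
(* Symmetry makes the degree exactly [2(K + 1)], so a root exists; positivity keeps it off the
   circle. *)
have spE : size p = K.+1.*2.+1.
  apply/eqP; rewrite eqn_leq sp ltnNge; apply/negP => /leq_sizeP/(_ _ (leqnn _)).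
  by move/eqP; rewrite p_coef // subnn conjC_eq0 (negPf p00).
have /closed_rootP[al /eqP p_al] : size p != 1%N by rewrite spE.
have al0 : al != 0.
  by apply: contra_neq p00 => al0; move: p_al; rewrite al0 horner_coef0.
have al1 : `|al| != 1.
  by apply/eqP => /p_gt0; rewrite p_al mul0r ltxx.
pose be := (al^*)^-1.
have be0 : be != 0 by rewrite invr_eq0 conjC_eq0.
have p_be : p.[be] = 0.
  by rewrite -p_sym horner_conj_rev // fmorphV /= conjCK invrK p_al conjC0 mulr0.
have be_al : be != al.
  apply/eqP => e; have : `|al| ^+ 2 = 1.
    by rewrite normCK -{1}e mulVf // conjC_eq0.
  by move/eqP; rewrite sqrf_eq1 (negPf al1) /= => /eqP h;
    have := normr_ge0 al; rewrite h ler0N1.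
have /factor_theorem[q1 q1E] : root p al by rewrite rootE p_al.
have /factor_theorem[q2 q2E] : root q1 be.
  move: p_be; rewrite q1E hornerM hornerXsubC => /eqP.
  rewrite mulf_eq0 subr_eq0.
  by rewrite (negPf be_al) orbF.
(* On the circle [z - be = - be * z * (z - al)^*]; the constant goes into [q], which thus inherits
   positivity. *)
pose q := - be *: q2.
have q_div z : `|z| = 1 -> p.[z] / z ^+ K.+1 = q.[z] / z ^+ K * `|z - al| ^+ 2.
  move=> z1; have z0 := circ_neq0 _ z1.
  have zz : z * z^* = 1 by rewrite -normCK z1 expr1n.
  have fact : z - be = - be * z * (z - al)^*.
    rewrite rmorphB /= /be; have := zz; set w := z^*; clearbody w => zw.
    have -> : - (al^*)^-1 * z * (w - al^*) =
              z * (al^* / al^*) - z * w / al^* by ring.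
    by rewrite zw divff ?conjC_eq0 // mulr1 mul1r.
  rewrite q1E q2E !hornerM !hornerXsubC fact hornerZ normCK exprSr.
  by field; rewrite z0 expf_neq0.
have sq : (size q <= K.*2.+1)%N.
  apply: leq_trans (size_scale_leq _ _) _.
  have q20 : q2 != 0.
    by apply: contra_eq_neq spE => q20; rewrite q1E q2E q20 !mul0r size_poly0.
  move: sp; rewrite q1E q2E !size_Mmonic ?monicXsubC ?mulf_neq0
    ?polyXsubC_eq0 //.
  by rewrite !size_XsubC !addn2 doubleS.
have [z z1|h sh hE] := IH q sq.
  have := p_gt0 z z1; rewrite q_div // pmulr_lgt0 //.
  rewrite exprn_gt0 // normr_gt0 subr_eq0.
  by apply: contraNneq al1 => <-; rewrite z1.
exists (h * ('X - al%:P)) => [|z z1].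
  apply: leq_trans (size_polyMleq _ _) _.
  by rewrite size_XsubC addn2.
by rewrite q_div // hE // hornerM hornerXsubC normrM exprMn.
Qed.

(** * Trigonometric sums *)

Lemma expiD (R : realType) (s t : R) : expi (s + t) = expi s * expi t.
Proof.
by apply/eqP; rewrite eq_complex /= cosD sinD [sin _ * _ + _]addrC !eqxx.
Qed.

Lemma expiX (R : realType) (t : R) k : expi t ^+ k = expi (k%:R * t).
Proof.
elim: k => [|k IH]; first by rewrite mul0r /expi cos0 sin0.
by rewrite exprSr IH -expiD -natr1 mulrDl mul1r.
Qed.

Lemma norm_expi (R : realType) (t : R) : `|expi t| = 1.
Proof. by rewrite normc_def /= cos2Dsin2 sqrtr1. Qed.

Lemma expi_neq0 (R : realType) (t : R) : expi t != 0.
Proof. by rewrite -normr_eq0 norm_expi oner_eq0. Qed.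

Lemma circle_expi (R : realType) (z : R[i]) :
  `|z| = 1 -> exists2 t : R, t \in `[0, 2 * pi] & z = expi t.
Proof.
case: z => x y; rewrite normc_def /= => -[h].
have {h} xy : x ^+ 2 + y ^+ 2 = 1.
  have h0 : 0 <= x ^+ 2 + y ^+ 2 by rewrite addr_ge0 ?sqr_ge0.
  by rewrite -(sqr_sqrtr h0) h expr1n.
have x1 : -1 <= x <= 1 by have := sqr_ge0 y; rewrite -ler_norml => ?; 
  rewrite -(@ler_sqr _ `|x| 1) ?nnegrE // ?real_normK ?num_real // expr1n; lra.
have c_x : cos (acos x) = x by rewrite acosK // in_itv.
have s_x : sin (acos x) = `|y|.
  by rewrite sin_acos // -xy addrAC subrr add0r sqrtr_sqr.
have p0 := pi_ge0 R; have a0 := acos_ge0 x1; have api := acos_lepi x1.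
have [y0|y0] := leP 0 y.
  exists (acos x); first by rewrite in_itv /=; apply/andP; split; lra.
  by rewrite /expi c_x s_x ger0_norm.
exists (2 * pi - acos x); first by rewrite in_itv /=; apply/andP; split; lra.
have -> : 2 * pi - acos x = - acos x + pi *+ 2 by rewrite mulr_natl addrC.
by rewrite /expi cosD2pi sinD2pi cosN sinN c_x s_x ltr0_norm ?opprK.
Qed.

Definition trig_sum (R : realType) (K : nat) (r s : nat -> R) (t : R) : R :=
  \sum_(j < K.+1) (r j * cos (j%:R * t) + s j * sin (j%:R * t)).

(** Pairing the indices [k] and [-k], with cosine even and sine odd, produces the data entries of
    the semidefinite program. *)
Lemma fourier_sumE (R : realType) (f : R -> R) K (t : R) :
  fourier_sum f K t = trig_sum K (re_entry f) (im_entry f) t.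
Proof.
pose g (k : int) := re_coef f k * cos (k%:~R * t) + im_coef f k * sin (k%:~R * t).
have -> : fourier_sum f K t = \sum_(m < (2 * K).+1) g (m%:Z - K%:Z).
  rewrite /fourier_sum /cfourier_sum.
  rewrite (raddf_sum (@complex.Re R : {additive Rcomplex R -> R})).
  apply: eq_bigr => m _; rewrite /g /re_coef /im_coef.
  case: (fourier_coef f (m%:Z - K%:Z)) => u v /=.
  by rewrite cosN sinN mulrN opprK.
have -> : \sum_(m < (2 * K).+1) g (m%:Z - K%:Z) =
    g 0 + \sum_(j < K) (g j.+1%:Z + g (- j.+1%:Z)).
  elim: K => [|K IH]; first by rewrite big_ord_recl !big_ord0 subrr.
  rewrite mulnS big_ord_recl [X in _ + X]big_ord_recr [in RHS]big_ord_recr /=.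
  rewrite [RHS]addrA -IH.
  have -> : 0 - K.+1%:Z = - K.+1%:Z by lia.
  have -> : (bump 0 (2 * K).+1)%:Z - K.+1%:Z = K.+1%:Z by rewrite /bump /=; lia.
  rewrite addrCA; congr (_ + _); last by rewrite addrC.
  apply: eq_bigr => m _; congr g; rewrite /bump /=; lia.
rewrite /trig_sum big_ord_recl /= !mul0r sin0 cos0; congr (_ + _).
  by rewrite /g /re_entry mul0r sin0 cos0 !mulr0.
apply: eq_bigr => j _; rewrite /g /re_entry /im_entry /= /bump /=.
rewrite mulrNz mulNr cosN sinN -[j.+1%:~R]/(j.+1%:R).
ring.
Qed.

Lemma trig_sumB (R : realType) K (r s r' s' : nat -> R) t :
  trig_sum K r s t - trig_sum K r' s' t =
  trig_sum K (fun j => r j - r' j) (fun j => s j - s' j) t.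
Proof.
rewrite /trig_sum -sumrB; apply: eq_bigr => j _; ring.
Qed.

(** On the circle this is [z ^+ K] times the trigonometric sum, the factor clearing negative
    exponents. At [j = 0] the two conjugate halves add up to [r 0]. *)
Definition laurent (R : realType) (K : nat) (r s : nat -> R) : {poly R[i]} :=
  \sum_(j < K.+1) ((Complex (r j / 2) (- (s j / 2))) *: 'X^(K + j) +
                   (Complex (r j / 2) (s j / 2)) *: 'X^(K - j)).

Lemma size_laurent (R : realType) K (r s : nat -> R) :
  (size (laurent K r s) <= K.*2.+1)%N.
Proof.
apply: leq_trans (size_sum _ _ _) _; apply/bigmax_leqP => j _.
apply: leq_trans (size_polyD _ _) _; rewrite geq_max.
apply/andP; split; apply: leq_trans (size_scale_leq _ _) _;
  rewrite size_polyXn ltnS -addnn.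
  by rewrite leq_add2l -ltnS.
by rewrite (leq_trans (leq_subr _ _)) // leq_addr.
Qed.

Lemma horner_laurent (R : realType) K (r s : nat -> R) t :
  (laurent K r s).[expi t] / expi t ^+ K = (trig_sum K r s t)%:C%C.
Proof.
rewrite /laurent horner_sum mulr_suml /trig_sum (rmorph_sum (real_complex R)).
apply: eq_bigr => j _; rewrite hornerD !hornerZ !hornerXn mulrDl -!mulrA.
have jK : (j <= K)%N by rewrite -ltnS.
have e0 k : expi t ^+ k != 0 by rewrite expf_neq0 ?expi_neq0.
have -> : expi t ^+ (K + j) / expi t ^+ K = expi (j%:R * t).
  by rewrite exprD mulrAC divff // mul1r expiX.
have -> : expi t ^+ (K - j) / expi t ^+ K = expi (- (j%:R * t)).
  apply: (mulIf (e0 j)); rewrite mulrAC -exprD subnK // divff //.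
  by rewrite expiX -expiD addNr /expi cos0 sin0.
rewrite /expi cosN sinN; apply/eqP; rewrite eq_complex /=.
by apply/andP; split; apply/eqP; field.
Qed.

Lemma coef_laurent (R : realType) K (r s : nat -> R) j : (j <= K)%N ->
  (laurent K r s)`_(K + j) =
  if j == 0%N then (r 0)%:C%C else Complex (r j / 2) (- (s j / 2)).
Proof.
move=> jK; rewrite /laurent coef_sum (bigD1 (Ordinal (jK : (j < K.+1)%N))) //=.
rewrite big1 ?addr0 => [|i /eqP /val_eqP /= ij]; rewrite coefD !coefZ !coefXn.
  rewrite eqxx mulr1; case: (eqVneq j 0%N) => [->|j0].
    rewrite subn0 addn0 eqxx mulr1; apply/eqP; rewrite eq_complex /=.
    by apply/andP; split; apply/eqP; field.
  rewrite (_ : (_ == _) = false) ?mulr0 ?addr0 //.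
  by apply/negbTE/eqP; lia.
have -> : (K + j == K + i)%N = false by rewrite eqn_add2l eq_sym (negPf ij).
have -> : (K + j == K - i)%N = false.
  apply/negbTE/eqP; move: ij (ltn_ord i).
  by rewrite -[_ == _]/((i : nat) == j); lia.
by rewrite !mulr0 addr0.
Qed.

(** The Laurent polynomials agree on the circle, hence coincide; their coefficients [K] to [2K]
    determine [r] and [s]. The value [s 0] only meets [sin 0], hence the proviso [0 < j]. *)
Lemma trig_sum_inj (R : realType) K (r s r' s' : nat -> R) :
  (forall t, trig_sum K r s t = trig_sum K r' s' t) ->
  forall j, (j <= K)%N -> r j = r' j /\ ((0 < j)%N -> s j = s' j).
Proof.
move=> eq_rs j jK.
have eqP : laurent K r s = laurent K r' s'.
  apply: eq_poly_circle => z /circle_expi[t _ ->].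
  apply: (mulIf (invr_neq0 (expf_neq0 K (expi_neq0 t)))).
  by rewrite !horner_laurent eq_rs.
have := congr1 (fun p : {poly R[i]} => p`_(K + j)) eqP.
rewrite !coef_laurent //; case: eqVneq => [->|_] []; first by split.
move=> r_eq s_eq; split=> [|_]; lra.
Qed.

(** * The semidefinite program *)

Lemma sum_indicator (R : pzRingType) (K d : nat) (F : nat -> R) : (d <= K)%N ->
  \sum_(j < K.+1) F j * (d == j)%:R = F d.
Proof.
move=> dK; rewrite (bigD1 (Ordinal (dK : (d < K.+1)%N))) //= eqxx mulr1.
rewrite big1 ?addr0 // => i /eqP/val_eqP/= ne.
by rewrite eq_sym (negPf ne) mulr0.
Qed.

Lemma sum_cos_C1 (R : realType) (K : nat) (k l : 'I_K.+1) (t : R) :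
  \sum_(j < K.+1) cos (j%:R * t) * C1 R K j k l =
  cos (k%:R * t) * cos (l%:R * t) + sin (k%:R * t) * sin (l%:R * t).
Proof.
pose d := `|k%:Z - l%:Z|%N.
have dK : (d <= K)%N by move: (ltn_ord k) (ltn_ord l); rewrite /d; lia.
rewrite (eq_bigr (fun j : 'I_K.+1 => cos (j%:R * t) * (d == j)%:R)); last first.
  by move=> j _; rewrite mxE -abszE.
rewrite (sum_indicator (fun j => cos (j%:R * t)) dK) -cosB -mulrBl.
have [kl|lk] := leqP k l.
  have -> : d%:R = - (k%:R - l%:R) :> R.
    by rewrite opprB -natrB //; congr (_%:R); rewrite /d; lia.
  by rewrite mulNr cosN.
by rewrite -natrB 1?ltnW //; congr (cos (_%:R * t)); rewrite /d; lia.
Qed.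

(** Only [j = |k - l|] contributes, with the sign of [l - k]. The term [j = 0], absent from the
    program, carries [sin 0]. *)
Lemma sum_sin_C2 (R : realType) (K : nat) (k l : 'I_K.+1) (t : R) :
  \sum_(j < K.+1) sin (j%:R * t) * C2 R K j k l =
  cos (k%:R * t) * sin (l%:R * t) - sin (k%:R * t) * cos (l%:R * t).
Proof.
pose d := `|k%:Z - l%:Z|%N.
have dK : (d <= K)%N by move: (ltn_ord k) (ltn_ord l); rewrite /d; lia.
have [kl|lk] := leqP k l.
  rewrite (eq_bigr (fun j : 'I_K.+1 => sin (j%:R * t) * (d == j)%:R));
    last first.
    move=> j _; rewrite mxE.
    have -> : (l%:Z - k%:Z == j%:Z) = (d == j) by rewrite /d; lia.
    case: eqVneq => // ne; rewrite (_ : (_ == _) = false) //.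
    by move: ne; rewrite /d; lia.
  rewrite (sum_indicator (fun j => sin (j%:R * t)) dK).
  rewrite [_ * sin _]mulrC [sin (k%:R * t) * _]mulrC -sinB -mulrBl -natrB //.
  by congr (sin (_%:R * t)); rewrite /d; lia.
rewrite (eq_bigr (fun j : 'I_K.+1 => (- sin (j%:R * t)) * (d == j)%:R));
  last first.
  move=> j _; rewrite mxE.
  have -> : (l%:Z - k%:Z == j%:Z) = false by lia.
  have -> : (k%:Z - l%:Z == j%:Z) = (d == j) by rewrite /d; lia.
  by case: eqVneq; rewrite ?mulr0 // mulrN mulNr.
rewrite (sum_indicator (fun j => - sin (j%:R * t)) dK).
rewrite -opprB -sinB -mulrBl -natrB 1?ltnW //.
by congr (- sin (_%:R * t)); rewrite /d; lia.
Qed.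

(** Traces against the constraint matrices, indexed by naturals to serve as coefficients of
    [trig_sum]; the minus sign in [sin_trace] matches that of [qvec] in the program. *)
Definition cos_trace (R : realType) K (Y : 'M[R]_(K.+1 + K.+1)) (j : nat) : R :=
  \tr (block_mx (C1 R K j) 0 0 (C1 R K j) *m Y).
Definition sin_trace (R : realType) K (Y : 'M[R]_(K.+1 + K.+1)) (j : nat) : R :=
  - \tr (block_mx 0 (- C2 R K j) (C2 R K j) 0 *m Y).

Definition cos_col (R : realType) K (t : R) : 'cV[R]_K.+1 :=
  \col_k cos (k%:R * t).
Definition sin_col (R : realType) K (t : R) : 'cV[R]_K.+1 :=
  \col_k sin (k%:R * t).

Lemma dot_mulmx (R : realType) m (Y : 'M[R]_m) (v : 'cV[R]_m) :
  dot v (Y *m v) = \tr (v *m v^T *m Y).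
Proof. by rewrite /dot mulmxA -trace_mx11 mxtrace_mulC mulmxA. Qed.

(** The blocks of [v v^T + w w^T] have entries [cos ((k - l) t)] on the diagonal and, up to sign,
    [sin ((l - k) t)] off it, so the matrix expands in the constraint matrices. *)
Lemma trig_sum_trace (R : realType) K (Y : 'M[R]_(K.+1 + K.+1)) (t : R) :
  let v := col_mx (cos_col K t) (sin_col K t) in
  let w := col_mx (- sin_col K t) (cos_col K t) in
  trig_sum K (cos_trace Y) (sin_trace Y) t = dot v (Y *m v) + dot w (Y *m w).
Proof.
move=> v w; rewrite !dot_mulmx -mxtraceD -mulmxDl.
have -> : v *m v^T + w *m w^T =
    \sum_(j < K.+1) (cos (j%:R * t) *: block_mx (C1 R K j) 0 0 (C1 R K j)
       - sin (j%:R * t) *: block_mx 0 (- C2 R K j) (C2 R K j) 0).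
  rewrite !tr_col_mx !mul_col_row add_block_mx.
  under eq_bigr do
    rewrite !scale_block_mx opp_block_mx add_block_mx !scaler0 !subr0
            !add0r scalerN opprK.
  have -> : forall F G H I : 'I_K.+1 -> 'M[R]_K.+1,
     \sum_j block_mx (F j) (G j) (H j) (I j) =
     block_mx (\sum_j F j) (\sum_j G j) (\sum_j H j) (\sum_j I j).
    move=> F G H I; elim: (index_enum _) => [|j s IH].
      by rewrite !big_nil block_mx_const.
    by rewrite !big_cons IH add_block_mx.
  congr block_mx; apply/matrixP => k l; rewrite summxE;
    under [in RHS]eq_bigr do rewrite mxE.
  - rewrite sum_cos_C1 !mxE !big_ord1 !mxE; ring.
  - rewrite sum_sin_C2 !mxE !big_ord1 !mxE; ring.
  - under [in RHS]eq_bigr do rewrite mxE.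
    rewrite sumrN sum_sin_C2 !mxE !big_ord1 !mxE; ring.
  - rewrite sum_cos_C1 !mxE !big_ord1 !mxE; ring.
rewrite mulmx_suml raddf_sum; apply: eq_bigr => j _ /=.
rewrite mulmxBl raddfB /= -!scalemxAl !mxtraceZ /sin_trace mulNr.
by congr (_ - _); exact: mulrC.
Qed.

Lemma dot_mulmx_rank1 (R : realType) m (y v : 'cV[R]_m) :
  dot v (y *m y^T *m v) = dot y v ^+ 2.
Proof.
rewrite /dot -mulmxA mulmxA [LHS]mxE big_ord1 expr2; congr (_ * _).
by rewrite -[v^T *m y]trmxK trmx_mul trmxK mxE.
Qed.

Lemma psd_rank1 (R : realType) m (y : 'cV[R]_m) : psd (y *m y^T).
Proof.
split; first by rewrite trmx_mul trmxK.
by move=> v; rewrite dot_mulmx_rank1 sqr_ge0.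
Qed.

Lemma trig_sum_gt0_trace (R : realType) K (r s : nat -> R) :
  (forall t, t \in `[0, 2 * pi] -> 0 < trig_sum K r s t) ->
  exists2 Y : 'M[R]_(K.+1 + K.+1), psd Y &
    forall j, (j <= K)%N ->
      cos_trace Y j = r j /\ ((0 < j)%N -> sin_trace Y j = s j).
Proof.
move=> rs_gt0.
have [z z1|h sh hE] := @fejer_riesz _ K (laurent K r s) (size_laurent K r s).
  by have [t tI ->] := circle_expi z1; rewrite horner_laurent ltcR rs_gt0.
(* With the vectors of [trig_sum_trace], [dot y v] is the real part of [h.[expi t]] and [dot y w]
   minus its imaginary part, so the squares add up to the squared modulus. *)
pose y := col_mx (\col_(k < K.+1) complex.Re h`_k)
                 (- \col_(k < K.+1) complex.Im h`_k).
exists (y *m y^T); first exact: psd_rank1.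
apply: trig_sum_inj => t.
have := hE _ (norm_expi t); rewrite horner_laurent.
rewrite (horner_coef_wide _ sh) -add_Re2_Im2.
rewrite !(raddf_sum (@complex.Re R : {additive Rcomplex R -> R})).
rewrite !(raddf_sum (@complex.Im R : {additive Rcomplex R -> R})).
move=> /complexI ->; rewrite trig_sum_trace !dot_mulmx_rank1; congr (_ + _).
  congr (_ ^+ 2); rewrite /dot tr_col_mx mul_row_col mxE !mxE.
  rewrite -big_split /=; apply: eq_bigr => k _; rewrite !mxE expiX.
  by case: (h`_k) => u v /=; rewrite mulNr.
rewrite -sqrrN; congr (_ ^+ 2).
rewrite /dot tr_col_mx mul_row_col mxE !mxE -big_split -sumrN /=.
apply: eq_bigr => k _; rewrite !mxE expiX.
by case: (h`_k) => u v /=; ring.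
Qed.

(** * Feasible sets of the truncated programs *)

Section truncated_program.
Context (R : realType) (n : nat) (c : 'cV[R]_n) (a : 'I_n.+1 -> R -> R).
Variables (K : nat) (x : 'cV[R]_n).

Definition cos_slack (j : nat) : R :=
  re_entry (a ord0) j - \sum_(i < n) re_entry (a (lift ord0 i)) j * x i 0.
Definition sin_slack (j : nat) : R :=
  im_entry (a ord0) j - \sum_(i < n) im_entry (a (lift ord0 i)) j * x i 0.

Lemma trig_sum_slack t :
  trig_sum K cos_slack sin_slack t =
  fourier_family a K ord0 t - lhs (fourier_family a K) x t.
Proof.
rewrite /lhs /fourier_family.
under eq_bigr do rewrite fourier_sumE /trig_sum mulr_suml.
rewrite exchange_big fourier_sumE /= -sumrB; apply: eq_bigr => j _.
rewrite /cos_slack /sin_slack !mulrBl !mulr_suml.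
have -> : forall u v w z : R, u - v + (w - z) = u + w - (v + z).
  by move=> *; ring.
congr (_ - _); rewrite -big_split; apply: eq_bigr => i _ /=; ring.
Qed.

Lemma feasible_TFP (Y : 'M[R]_(K.+1 + K.+1)) :
  feasible (TFP c a K) (x, Y) <->
  psd Y /\ forall j, (j <= K)%N ->
    cos_trace Y j = cos_slack j /\ ((0 < j)%N -> sin_trace Y j = sin_slack j).
Proof.
split=> [[/= cosE sinE psdY]|[psdY tr]].
  split=> // j jK; split.
    have /matrixP/(_ (Ordinal (jK : (j < K.+1)%N)) 0) := cosE.
    rewrite !mxE /cos_trace /cos_slack.
    under eq_bigr do rewrite !mxE.
    by move=> /= e; rewrite /C1bar in e; lra.
  case: j jK => // j jK _.
  have /matrixP/(_ (Ordinal jK) 0) := sinE.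
  rewrite !mxE /sin_trace /sin_slack.
  under eq_bigr do rewrite !mxE.
  by move=> /= e; rewrite /C2bar /= in e; lra.
split=> //=; apply/matrixP => j k; rewrite ord1 !mxE.
  have [+ _] := tr j (leq_ord j); rewrite /cos_trace /cos_slack.
  under [\sum_j (Emx _ _)^T _ _ * _]eq_bigr do rewrite !mxE.
  by rewrite /C1bar; lra.
have [_ /(_ isT)] := tr j.+1 (ltn_ord j); rewrite /sin_trace /sin_slack.
under [\sum_j (Fmx _ _)^T _ _ * _]eq_bigr do rewrite !mxE.
by rewrite /C2bar; lra.
Qed.

Lemma TFP_FP (Y : 'M[R]_(K.+1 + K.+1)) :
  feasible (TFP c a K) (x, Y) -> feasible (FP c a K) x.
Proof.
move=> /feasible_TFP[[_ psdY] tr] t _.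
rewrite -subr_ge0 -trig_sum_slack.
rewrite (_ : trig_sum _ _ _ _ = trig_sum K (cos_trace Y) (sin_trace Y) t).
  by rewrite trig_sum_trace addr_ge0.
apply: eq_bigr => j _; have [<- sE] := tr j (leq_ord j).
by case: (posnP j) sE => [->|j0 ->//]; rewrite mul0r sin0 !mulr0.
Qed.

(** Strictness provides the positivity that [fejer_riesz] asks for; lifting strictly feasible points
    is enough for the final comparison. *)
Lemma FP_TFP :
  (forall t, t \in `[0, 2 * pi] ->
    lhs (fourier_family a K) x t < fourier_family a K ord0 t) ->
  exists Y, feasible (TFP c a K) (x, Y).
Proof.
move=> x_lt; have [t tI|Y psdY tr] := @trig_sum_gt0_trace _ K cos_slack sin_slack.
  by rewrite trig_sum_slack subr_gt0 x_lt.
by exists Y; apply/feasible_TFP; split=> // j /tr[-> sE].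
Qed.

End truncated_program.

(** * Stability of linear semi-infinite programs *)

(** Dual to a uniform bound on the data: an error [e] in every coefficient costs at most
    [e * l1norm x]. *)
Definition l1norm (R : realType) n (x : 'cV[R]_n) : R := \sum_(j < n) `|x j 0|.

Lemma l1norm_ge0 (R : realType) n (x : 'cV[R]_n) : 0 <= l1norm x.
Proof. by apply: sumr_ge0 => j _; apply: normr_ge0. Qed.

Lemma l1normD (R : realType) n (x y : 'cV[R]_n) :
  l1norm (x + y) <= l1norm x + l1norm y.
Proof.
by rewrite /l1norm -big_split; apply: ler_sum => j _; rewrite mxE ler_normD.
Qed.

Lemma l1normZ (R : realType) n (s : R) (x : 'cV[R]_n) :
  l1norm (s *: x) = `|s| * l1norm x.
Proof.
by rewrite /l1norm mulr_sumr; apply: eq_bigr => j _; rewrite mxE normrM.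
Qed.

Lemma l1norm_eq0 (R : realType) n (x : 'cV[R]_n) : (l1norm x == 0) = (x == 0).
Proof.
apply/idP/eqP => [|->]; last first.
  by rewrite /l1norm big1 // => j _; rewrite mxE normr0.
rewrite psumr_eq0 // => /allP x0; apply/matrixP => j k; rewrite ord1 mxE.
have /(_ (mem_index_enum _)) := x0 j.
by rewrite normr_eq0 => /eqP.
Qed.

Lemma dotE (R : realType) n (u v : 'cV[R]_n) : dot u v = \sum_j u j 0 * v j 0.
Proof. by rewrite /dot mxE; apply: eq_bigr => j _; rewrite mxE. Qed.

Lemma dotDr (R : realType) n (u v w : 'cV[R]_n) :
  dot u (v + w) = dot u v + dot u w.
Proof. by rewrite /dot mulmxDr mxE. Qed.

Lemma dotZr (R : realType) n (s : R) (u v : 'cV[R]_n) :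
  dot u (s *: v) = s * dot u v.
Proof. by rewrite /dot -scalemxAr mxE. Qed.

(** If no [eta] worked, [l1norm]-unit vectors with all products at most [1 / (m + 1)] would cluster
    at a unit vector with all products nonpositive. *)
Lemma pos_functional_bound (R : realType) n (S : set 'cV[R]_n) :
  (forall d, (forall v, S v -> dot v d <= 0) -> d = 0) ->
  exists2 eta : R, 0 < eta &
    forall x, x != 0 -> exists2 v, S v & eta * l1norm x <= dot v x.
Proof.
move=> rec0; apply: contrapT => no_eta.
have bad (m : nat) : exists u : 'rV[R]_n,
    l1norm u^T = 1 /\ forall v, S v -> dot v u^T <= m.+1%:R^-1.
  apply: contrapT => no_u; apply: no_eta; exists m.+1%:R^-1.
    by rewrite invr_gt0.
  move=> x x0; apply: contrapT => no_v; apply: no_u.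
  have l0 : 0 < l1norm x by rewrite lt_def l1norm_ge0 l1norm_eq0 x0.
  exists ((l1norm x)^-1 *: x)^T; rewrite trmxK; split.
    by rewrite l1normZ ger0_norm ?invr_ge0 1?ltW // mulVf // gt_eqF.
  move=> v Sv; rewrite dotZr mulrC ler_pdivrMr // leNgt; apply/negP => lt.
  by apply: no_v; exists v => //; apply: ltW.
have {bad} [u u_bad] := choice bad.
pose sphere := [set w : 'rV[R]_n | l1norm w^T = 1].
have coordc j : continuous (fun w : 'rV[R]_n => w^T j 0).
  rewrite (_ : (fun w => _) = fun w : 'rV[R]_n => w 0 j).
    exact: coord_continuous.
  by apply/funext => w; rewrite mxE.
have sphere_compact : compact sphere.
  apply: bounded_closed_compact.
    exists 1; split=> // M M1 w /= w1; apply: le_trans (ltW M1).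
    rewrite [leLHS]/Num.Def.normr /= mx_normrE.
    apply/bigmax_leP; split=> //= -[i j] _ /=.
    rewrite -w1 /l1norm (bigD1 j) //= mxE (ord1 i) lerDl.
    by apply: sumr_ge0 => k _; apply: normr_ge0.
  apply: (@preimage_closed _ _ (fun w : 'rV[R]_n => l1norm w^T) [set 1]);
    last exact: closed_eq.
  move=> w _; apply: continuous_big => [|j _ {}w]; first exact: add_continuous.
  exact: (cvg_norm (coordc j w)).
have u_sphere : (u @ \oo) sphere by exists 0%N => // m _; have [] := u_bad m.
have [p [/= p1 p_cluster]] := sphere_compact (u @ \oo) _ u_sphere.
have p_le0 v : S v -> dot v p^T <= 0.
  move=> Sv; rewrite leNgt; apply/negP => p_gt0.
  (* The tail of [u] lies in the closed half-space at level [e], hence so does its cluster point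
     [p]. *)
  pose e := dot v p^T / 2.
  have e0 : 0 < e by rewrite divr_gt0.
  have closed_e : closed [set w : 'rV[R]_n | dot v w^T <= e].
    apply: (@preimage_closed _ _ (fun w : 'rV[R]_n => dot v w^T)
              [set x | x <= e]); last exact: closed_le.
    move=> w _; under eq_fun do rewrite dotE.
    apply: continuous_big => [|j _ {}w]; first exact: add_continuous.
    exact: (cvgM (cvg_cst (v j 0)) (coordc j w)).
  move: p_cluster; rewrite clusterE => /(_ [set w : 'rV[R]_n | dot v w^T <= e]).
  move/closure_id: closed_e => <-.
  have F_e : \forall m \near \oo, dot v (u m)^T <= e.
    have := near_infty_natSinv_lt (PosNum e0).
    apply: filterS => m /= /ltW; apply: le_trans.
    by have [_] := u_bad m; apply.
  move=> /(_ F_e) /=; rewrite /e; lra.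
by have /eqP := rec0 _ p_le0; rewrite -l1norm_eq0 p1 oner_eq0.
Qed.

Lemma optimal_valueE (R : realType) V (P : program R V) x :
  optimal P x -> optimal_value P = (objective P x)%:E.
Proof.
move=> [Fx x_min]; apply/eqP; rewrite eq_le; apply/andP; split.
  by apply: ereal_inf_lbound; exists x.
by apply: le_ereal_inf_tmp => _ [y Fy <-]; rewrite lee_fin x_min.
Qed.

Lemma enorm_ge0 (R : realType) n (x : 'cV[R]_n) : 0 <= enorm x.
Proof. exact: sqrtr_ge0. Qed.

Lemma enormZ (R : realType) n (s : R) (x : 'cV[R]_n) :
  enorm (s *: x) = `|s| * enorm x.
Proof.
rewrite /enorm; under eq_bigr do rewrite mxE exprMn.
by rewrite -mulr_sumr sqrtrM ?sqr_ge0 // sqrtr_sqr.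
Qed.

Lemma enorm_coord (R : realType) n (x : 'cV[R]_n) j : `|x j 0| <= enorm x.
Proof.
rewrite -sqrtr_sqr ler_wsqrtr // (bigD1 j) //= lerDl.
by apply: sumr_ge0 => i _; apply: sqr_ge0.
Qed.

Lemma edist_le (R : realType) n (x y : 'cV[R]_n) (S : set 'cV[R]_n) :
  S y -> Defs.edist x S <= enorm (x - y).
Proof.
move=> Sy; apply: ge_inf; last by exists y.
by exists 0 => _ [z _ <-]; apply: enorm_ge0.
Qed.

(** * Constraint functions and recession directions *)

Section lhs_theory.
Context (R : realType) (n : nat).
Implicit Types (a b : 'I_n.+1 -> R -> R) (x y : 'cV[R]_n).

Lemma lhs_dot a x t : lhs a x t = dot (\col_j a (lift ord0 j) t) x.
Proof. by rewrite dotE; apply: eq_bigr => j _; rewrite mxE. Qed.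

Lemma lhsD a x y t : lhs a (x + y) t = lhs a x t + lhs a y t.
Proof. by rewrite !lhs_dot dotDr. Qed.

Lemma lhsZ a s x t : lhs a (s *: x) t = s * lhs a x t.
Proof. by rewrite !lhs_dot dotZr. Qed.

Lemma lhs_perturbation a b x t e :
  (forall j, `|a j t - b j t| <= e) ->
  `|lhs a x t - lhs b x t| <= e * l1norm x.
Proof.
move=> ab; rewrite /lhs -sumrB mulr_sumr; apply: le_trans (ler_norm_sum _ _ _) _.
by apply: ler_sum => j _; rewrite -mulrBl normrM ler_wpM2r.
Qed.

(** An optimal point moved along [d] stays optimal, so a nonzero [d] would give an unbounded optimal
    ray. *)
Lemma lsip_recession (c : 'cV[R]_n) a (rad : R) d :
  optimal (lsip c a) !=set0 ->
  (forall x, optimal (lsip c a) x -> enorm x <= rad) ->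
  (forall t, t \in `[0, 2 * pi] -> lhs a d t <= 0) -> dot c d <= 0 -> d = 0.
Proof.
move=> [x [Fx x_min]] bnd lhs_d c_d; apply/matrixP => j k; rewrite ord1 mxE.
apply: contrapT => /eqP dj.
have dj0 : 0 < `|d j 0| by rewrite normr_gt0.
(* Coordinate [j] moves by [rad + 1 + |x_j|], hence ends above [rad] in absolute value. *)
pose s := (rad + 1 + `|x j 0|) / `|d j 0|.
have rad0 : 0 <= rad by apply: le_trans (bnd x _); rewrite ?enorm_ge0.
have s0 : 0 <= s by rewrite divr_ge0 // !addr_ge0.
have /bnd : optimal (lsip c a) (x + s *: d).
  split=> [t tI|y Fy] /=.
    by have := Fx t tI; have := lhs_d t tI; rewrite lhsD lhsZ; nra.
  by have := x_min y Fy; rewrite /= dotDr dotZr; nra.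
apply/negP; rewrite -ltNge; apply: lt_le_trans (enorm_coord _ j).
have e : `|s * d j 0| = rad + 1 + `|x j 0|.
  by rewrite normrM (ger0_norm s0) divfK // gt_eqF.
rewrite !mxE; have := ler_normB (x j 0 + s * d j 0) (x j 0).
rewrite [X in `|X|]addrC addKr e; lra.
Qed.

End lhs_theory.

(** * Stability under perturbation of the data *)

Section stability.
Context (R : realType) (n : nat) (c : 'cV[R]_n) (a : 'I_n.+1 -> R -> R).
Variables (xt : 'cV[R]_n) (Q : R).
Hypotheses (Q_lt0 : Q < 0)
  (lhs_xt : forall t, t \in `[0, 2 * pi] -> lhs a xt t <= Q).
Hypothesis optimal_P : optimal (lsip c a) !=set0.
Variable rad : R.
Hypothesis bounded_P : forall x, optimal (lsip c a) x -> enorm x <= rad.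
Variable B : R.
Hypothesis a0_le : forall t, t \in `[0, 2 * pi] -> a ord0 t <= B.

(** This is [pos_functional_bound] for the objective and all constraint vectors; [lsip_recession]
    supplies its hypothesis. *)
Lemma lsip_linear_growth :
  exists2 eta : R, 0 < eta & forall x,
    eta * l1norm x <= dot c x \/
    exists2 t, t \in `[0, 2 * pi] & eta * l1norm x <= lhs a x t.
Proof.
pose S := [set v | v = c \/
  exists2 t, t \in `[0, 2 * pi] & v = \col_j a (lift ord0 j) t].
have [d d_le0|eta eta0 etaP] := @pos_functional_bound _ _ S.
  apply: lsip_recession optimal_P bounded_P _ _ => [t tI|].
    by rewrite lhs_dot; apply: d_le0; right; exists t.
  by apply: d_le0; left.
exists eta => // x; have [->|x0] := eqVneq x 0.
  left; have /eqP -> : l1norm (0 : 'cV[R]_n) == 0 by rewrite l1norm_eq0.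
  by rewrite mulr0 /dot mulmx0 mxE.
have [v [->|[t tI ->]] le] := etaP x x0; [by left|right].
by exists t => //; rewrite lhs_dot.
Qed.

(** To serve all three programs, [x] need not be optimal, only feasible for a relaxation and no
    worse than the Slater point [y]. The constants precede [b] and [eps], hence are uniform in the
    truncation factor. *)
Lemma lsip_stability (A D : R) : 0 < A -> 0 <= D ->
  exists2 L : R, 0 < L & exists2 eps0 : R, 0 < eps0 &
    forall (b : 'I_n.+1 -> R -> R) (eps : R), 0 < eps < eps0 ->
    (forall j t, t \in `[0, 2 * pi] -> `|a j t - b j t| <= A * eps) ->
    exists y,
      (forall t, t \in `[0, 2 * pi] -> lhs b y t < b ord0 t) /\
      forall x, feasible (relaxed_lsip c b (D * eps)) x ->
        dot c x <= dot c y -> eps_optimal (lsip c a) L eps x.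
Proof.
move=> A0 D0; have [eta eta0 etaP] := lsip_linear_growth.
have [xs xs_opt] := optimal_P; have [Fxs xs_min] := xs_opt.
pose q := - Q; have q0 : 0 < q by rewrite oppr_gt0.
(* Moving [C * eps] along [xt] gains slack [C * eps * q]: half pays for the data error at [xs], half
   for that on the shift. *)
pose C := 2 * (l1norm xs + 1) * A / q.
pose w := `|dot c xt|.
(* Will bound [l1norm x], with one summand per alternative of [lsip_linear_growth]. *)
pose M := (`|dot c xs| + 1) / eta + 2 * (`|B| + 1) / eta.
(* [G * eps] will bound the violation of (P) by [x]: right-hand side error, relaxation, left-hand
   side error. *)
pose G := A + D + A * M.
have ls0 := l1norm_ge0 xs; have lt0 := l1norm_ge0 xt.
have w0 : 0 <= w := normr_ge0 _.
have C_gt0 : 0 < C by rewrite divr_gt0 // !mulr_gt0 // ltr_wpDl.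
have C0 := ltW C_gt0.
have Cq : C * q = 2 * (l1norm xs + 1) * A by rewrite divfK // gt_eqF.
have M0 : 0 <= M.
  by rewrite addr_ge0 // divr_ge0 ?(ltW eta0) // ?mulr_ge0 // addr_ge0.
have G0 : 0 <= G by rewrite !addr_ge0 ?mulr_ge0 ?(ltW A0).
have Gq0 : 0 <= G / q by rewrite divr_ge0 // ltW.
pose k1 := 2 * l1norm xt * A / q; pose k3 := 2 * A / eta.
have k10 : 0 <= k1 by rewrite divr_ge0 ?(ltW q0) // !mulr_ge0 // ltW.
have k30 : 0 <= k3 by rewrite divr_ge0 ?(ltW eta0) // mulr_ge0 // ltW.
have Cw0 : 0 <= C * w by rewrite mulr_ge0.
(* [C * w] and [G / q * w] control the value from above and below, [G / q * enorm xt] the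
   distance. *)
exists ((C + G / q) * (w + enorm xt) + 1).
  by rewrite ltr_wpDl // mulr_ge0 ?addr_ge0 ?enorm_ge0.
(* Each of the first four summands gives one smallness condition on [eps]; the last makes [k]
   positive. *)
pose k := k1 + C * w + k3 + (A + D) + 1.
have k_gt0 : 0 < k by rewrite ltr_wpDl // !addr_ge0 ?(ltW A0).
exists k^-1; first by rewrite invr_gt0.
move=> b eps /andP[eps0]; rewrite -[_^-1]mul1r ltr_pdivlMr // => eps_k ab.
have ek1 : eps * k1 < 1 by rewrite /k in eps_k; nra.
have eCw : eps * (C * w) < 1 by rewrite /k in eps_k; nra.
have ek3 : eps * k3 < 1 by rewrite /k in eps_k; nra.
have eAD : eps * (A + D) < 1 by rewrite /k in eps_k; nra.
have {ek1} ek1 : 2 * l1norm xt * A * eps < q.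
  by move: ek1; rewrite mulrA ltr_pdivrMr // mul1r; lra.
have {ek3} ek3 : 2 * A * eps < eta.
  by move: ek3; rewrite mulrA ltr_pdivrMr // mul1r; lra.
have lhs_ab x t : t \in `[0, 2 * pi] ->
    `|lhs a x t - lhs b x t| <= A * eps * l1norm x.
  by move=> tI; apply: lhs_perturbation => j; apply: ab.
have Ce0 : 0 <= C * eps := mulr_ge0 C0 (ltW eps0).
pose y := xs + (C * eps) *: xt.
have cy : dot c y <= dot c xs + C * eps * w.
  by rewrite /y dotDr dotZr lerD2l ler_wpM2l ?ler_norm ?Ce0.
exists y; split=> [t tI|x Fx cx].
  have ly : l1norm y <= l1norm xs + C * eps * l1norm xt.
    apply: le_trans (l1normD _ _) _.
    by rewrite l1normZ ger0_norm.
  have := lhs_ab y t tI; have := ab ord0 t tI; rewrite !ler_norml.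
  move=> /andP[h1 h2] /andP[h3 h4].
  have h5 : lhs a y t <= a ord0 t - C * eps * q.
    rewrite /y lhsD lhsZ; have := Fxs t tI; have := lhs_xt tI => /=.
    rewrite /q.
    nra.
  have h6 : A * eps * l1norm y <= A * eps * (l1norm xs + C * eps * l1norm xt).
    by rewrite ler_wpM2l // mulr_ge0 ?ltW.
  have h7 : C * eps * (2 * l1norm xt * A * eps) < C * eps * q.
    by rewrite ltr_pM2l // mulr_gt0.
  have h8 : C * eps * q = 2 * (l1norm xs + 1) * (A * eps).
    by rewrite mulrAC Cq mulrA.
  lra.
have lhs_x t : t \in `[0, 2 * pi] ->
    lhs a x t <= a ord0 t + (A + D) * eps + A * eps * l1norm x.
  move=> tI; have := lhs_ab x t tI; have := ab ord0 t tI; have /= := Fx t tI.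
  rewrite !ler_norml => h1 /andP[h2 h3] /andP[h4 h5]; lra.
have lx : l1norm x <= M.
  have u0 : 0 <= (`|dot c xs| + 1) / eta by rewrite divr_ge0 ?addr_ge0 // ltW.
  have v0 : 0 <= 2 * (`|B| + 1) / eta.
    by rewrite divr_ge0 ?mulr_ge0 ?addr_ge0 // ltW.
  have [h|[t tI h]] := etaP x.
    apply: (@le_trans _ _ ((`|dot c xs| + 1) / eta)); last by rewrite lerDl.
    rewrite ler_pdivlMr // mulrC.
    have := ler_norm (dot c xs); lra.
  apply: (@le_trans _ _ (2 * (`|B| + 1) / eta)); last by rewrite lerDr.
  rewrite ler_pdivlMr //.
  have h1 := lhs_x t tI; have h2 := a0_le tI; have h3 := ler_norm B.
  (* The error term growing with [x] is absorbed by half of the linear growth. *)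
  have h4 : 2 * A * eps * l1norm x <= eta * l1norm x.
    by rewrite ler_wpM2r ?l1norm_ge0 // ltW.
  lra.
have x_slack t : t \in `[0, 2 * pi] -> lhs a x t <= a ord0 t + G * eps.
  move=> tI; have := lhs_x t tI.
  have : A * eps * l1norm x <= A * eps * M by rewrite ler_wpM2l // mulr_ge0 ?ltW.
  rewrite /G; lra.
(* Moving [s] along [xt] lowers each constraint function by at least [s * q = G * eps], which
   repairs the violation. *)
pose s := G / q * eps.
have s0 : 0 <= s by rewrite mulr_ge0 // ltW.
have Fz : feasible (lsip c a) (x + s *: xt).
  move=> t tI; rewrite lhsD lhsZ.
  have : s * lhs a xt t <= - (G * eps).
    have -> : G * eps = s * q by rewrite /s mulrAC divfK // gt_eqF.
    by rewrite -mulrN opprK ler_wpM2l // lhs_xt.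
  have := x_slack t tI; lra.
split.
  rewrite (optimal_valueE xs_opt) -EFinB lee_fin /=.
  have h1 := xs_min _ Fz; rewrite /= dotDr dotZr in h1.
  have h2 : s * dot c xt <= s * w by rewrite ler_wpM2l // ler_norm.
  have h3 : 0 <= s * enorm xt by rewrite mulr_ge0 ?enorm_ge0.
  have h4 : 0 <= C * eps * enorm xt by rewrite mulr_ge0 ?enorm_ge0.
  have h5 : 0 <= C * eps * w by rewrite mulr_ge0.
  have h6 : 0 <= s * w by rewrite mulr_ge0.
  rewrite ler_norml /s in h2 h3 h6 h1 *; apply/andP; split; lra.
apply: le_trans (edist_le _ Fz) _.
rewrite opprD addNKr -scaleNr enormZ normrN ger0_norm //.
have h4 : 0 <= C * eps * enorm xt by rewrite mulr_ge0 ?enorm_ge0.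
have h5 : 0 <= C * eps * w by rewrite mulr_ge0.
have h6 : 0 <= s * w by rewrite mulr_ge0.
rewrite /s in h6 *; lra.
Qed.

End stability.

(** * Convergence rate and conclusion *)

Lemma rate_small (R : realType) (e : R) :
  0 < e -> \forall K \near \oo, 0 < rate R K < e.
Proof.
move=> e0; near=> K.
have K1 : (1 < K)%N by near: K; exact: nbhs_infty_gt.
have K0 : 0 < K%:R :> R by rewrite ltr0n ltnW.
rewrite /rate divr_gt0 ?ln_gt0 ?ltr1n //=.
have sK0 : 0 < Num.sqrt (K%:R : R) by rewrite sqrtr_gt0.
have sKe : 2 / e < Num.sqrt K%:R.
  have e20 : 0 <= 2 / e by rewrite divr_ge0 // ltW.
  rewrite -(ger0_norm e20) -sqrtr_sqr ltr_sqrt //.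
  by near: K; exact: nbhs_infty_gtr.
(* [ln K = 2 ln (sqrt K)] is at most [2 sqrt K], so the rate is at most [2 / sqrt K]. *)
rewrite ltr_pdivrMr // -{1 2}(sqr_sqrtr (ltW K0)) lnXn //.
have := ln_sublinear sK0; rewrite ltr_pdivrMr // in sKe.
have := sKe; rewrite -(ltr_pM2r sK0) -mulr_natl; lra.
Unshelve. all: by end_near.
Qed.

Lemma lipschitz_segment_bounded (R : realType) (f : R -> R) (u v : R) :
  [lipschitz (f : R^o -> R^o) t | t in `[u, v]] ->
  exists B, forall t, t \in `[u, v] -> f t <= B.
Proof.
move=> /pinfty_ex_gt0[k k0 f_lip].
exists (f u + k * (v - u)) => t; rewrite in_itv /= => /andP[ut tv].
have := f_lip (t, u); rewrite /= !in_itv /= lexx ut tv (le_trans ut tv).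
move=> /(_ (conj isT isT)); rewrite [X in _ * X]ger0_norm ?subr_ge0 //.
move=> /(le_trans (ler_norm _)); rewrite lerBlDl => /le_trans -> //.
by rewrite lerD2l ler_pM2l // lerB.
Qed.

Theorem theorem5p1 (R : realType) (n : nat) (n_ge1 : (1 <= n)%N)
    (c : 'cV[R]_n) (a : 'I_n.+1 -> R -> R)
    (a_lipschitz : forall j : 'I_n.+1,
      [lipschitz (a j : R^o -> R^o) t | t in `[0, 2 * pi]])
    (a_periodic : forall j : 'I_n.+1, a j 0 = a j (2 * pi))
    (slater_P : slater a)
    (negative_direction : exists (x : 'cV[R]_n) (Q : R), Q < 0 /\
      forall t, t \in `[0, 2 * pi] -> lhs a x t <= Q)
    (c_neq0 : c != 0)
    (optimal_P : optimal (lsip c a) !=set0)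
    (rad : R)
    (optimal_P_bounded : forall x, optimal (lsip c a) x -> enorm x <= rad)
    (A : R) (A_gt0 : 0 < A)
    (A_bound : forall (j : 'I_n.+1) (K : nat) (t : R), (2 <= K)%N ->
      t \in `[0, 2 * pi] -> `|a j t - fourier_sum (a j) K t| <= A * rate R K) :
  [/\ \forall K \near \oo, slater (fourier_family a K),
      exists2 L : R, 0 < L & \forall K \near \oo, forall x : 'cV[R]_n,
        optimal (AFP c a A rad K) x -> eps_optimal (lsip c a) L (rate R K) x,
      exists2 L : R, 0 < L & \forall K \near \oo, forall x : 'cV[R]_n,
        optimal (FP c a K) x -> eps_optimal (lsip c a) L (rate R K) x
    & exists2 L : R, 0 < L & \forall K \near \oo,
        forall (x : 'cV[R]_n) (Y : 'M[R]_(K.+1 + K.+1)),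
        optimal (TFP c a K) (x, Y) -> eps_optimal (lsip c a) L (rate R K) x].
Proof.
have [xt [Q [Q0 lhs_xt]]] := negative_direction.
have [B a0_le] := lipschitz_segment_bounded (a_lipschitz ord0).
(* [D = 0] serves [FP] and [TFP]; [AFP] takes its own relaxation constant. *)
have stable D : 0 <= D -> exists2 L : R, 0 < L & \forall K \near \oo, exists y,
    (forall t, t \in `[0, 2 * pi] ->
       lhs (fourier_family a K) y t < fourier_family a K ord0 t) /\
    forall x, feasible (relaxed_lsip c (fourier_family a K) (D * rate R K)) x ->
      dot c x <= dot c y -> eps_optimal (lsip c a) L (rate R K) x.
  move=> D0.
  have [L L0 [eps0 eps0_gt0 stab]] := lsip_stability Q0 lhs_xt optimal_P
    optimal_P_bounded a0_le A_gt0 D0.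
  exists L => //; near=> K.
  apply: stab; first by near: K; exact: rate_small.
  by move=> j t; apply: A_bound; near: K; exact: nbhs_infty_ge.
have FP_relaxed K x : feasible (FP c a K) x ->
    feasible (relaxed_lsip c (fourier_family a K) (0 * rate R K)) x.
  by move=> Fx t tI; rewrite mul0r addr0; apply: Fx.
have rad0 : 0 <= rad.
  by have [x /optimal_P_bounded] := optimal_P; apply: le_trans; apply: enorm_ge0.
have D0 : 0 <= 2 * (n%:R * rad + 1) * A.
  by rewrite !mulr_ge0 ?addr_ge0 ?mulr_ge0 // ltW.
have [L L0 stab] := stable 0 (lexx 0).
have [L' L'0 stab'] := stable _ D0.
split.
- by apply: filterS stab => K [y [y_lt _]]; exists y.
- exists L' => //; near=> K => x [Fx x_min].
  have [y [y_lt y_opt]] : exists y, (forall t, t \in `[0, 2 * pi] ->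
       lhs (fourier_family a K) y t < fourier_family a K ord0 t) /\
    forall x, feasible (AFP c a A rad K) x ->
      dot c x <= dot c y -> eps_optimal (lsip c a) L' (rate R K) x by near: K.
  (* The relaxation is nonnegative, so [y] is feasible for [AFP] and [x] is no worse. *)
  apply: y_opt => //; apply: x_min => t tI; apply: le_trans (ltW (y_lt t tI)) _.
  rewrite lerDl mulr_ge0 //.
  suff /andP[/ltW] : 0 < rate R K < 1 by [].
  by near: K; exact: rate_small.
- exists L => //; apply: filterS stab => K [y [y_lt y_opt]] x [Fx x_min].
  by apply: y_opt (FP_relaxed _ _ Fx) _; apply: x_min => t /y_lt /ltW.
(* Here [x] is feasible for [FP], while the strictly feasible [y] lifts to a pair against which
   [(x, Y)] is compared. *)
- exists L => //; apply: filterS stab => K [y [y_lt y_opt]] x Y [Fx x_min].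
  apply: y_opt; first exact/FP_relaxed/(TFP_FP Fx).
  by have [Z Fy] := FP_TFP c y_lt; apply: x_min Fy.
Unshelve. all: by end_near.
Qed.
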